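(* Let $r\in\mathbb N$, let $L_r$ be a nonempty subset of $\{2,4,\dots,2r\}$, and let $n\in\mathbb N_0$. Let $\mathcal P_e(n,L_r,2r)$ (resp. $\mathcal P_o(n,L_r,2r)$) be the set of partitions of $n$ in which odd parts are unrestricted, every even part is congruent modulo $2r$ to some element of $L_r$, and the number of even parts (with multiplicity) is even (resp. odd). For $m\in\mathbb N_0$ let $\mathcal Q(m,L_r,r)$ be the set of partitions of $m$ into distinct parts in which no even part is congruent modulo $2r$ to an element of $L_r$. Then \[ \sum_{\lambda\in\mathcal P_e(n,L_r,2r)}\ell(\lambda)-\sum_{\lambda\in\mathcal P_o(n,L_r,2r)}\ell(\lambda)-\sum_{\lambda\in\mathcal Q(n,L_r,r)}\ell(\lambda) \] equals the number of pairs $(\lambda,(a^b))$ with $a,b$ positive integers such that (i) $a$ is even, and (ii) $\lambda\in\mathcal Q(n-ab,L_r,r)$.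
   Context: A partition is a non-increasing sequence of positive integers; the empty partition is allowed for $\lambda$. $(a^b)$ denotes the partition with $b$ parts equal to $a$. $\ell(\lambda)$ is the number of parts of $\lambda$ counted with multiplicity. *)

(* Defs.v *)
From HB Require Import structures.
From mathcomp Require Export all_boot all_order all_algebra finmap.
From mathcomp Require Export all_classical.

Set Implicit Arguments.
Unset Strict Implicit.
Unset Printing Implicit Defensive.

Local Open Scope classical_set_scope.

Definition is_partition (s : seq nat) : bool :=
  sorted geq s && all (fun x => 0 < x) s.

Definition partitions (n : nat) : set (seq nat) :=
  [set s | is_partition s /\ sumn s = n].

Definition ell (s : seq nat) : nat := size s.

Definition num_even (s : seq nat) : nat := count (fun x => ~~ odd x) s.

Definition cong_to (r : nat) (L : set nat) (x : nat) : Prop :=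
  exists2 e, L e & x = e %[mod 2 * r].

Definition P_e (n : nat) (L : set nat) (r : nat) : set (seq nat) :=
  [set s | [/\ partitions n s,
               forall x, x \in s -> ~~ odd x -> cong_to r L x
             & ~~ odd (num_even s)]].

Definition P_o (n : nat) (L : set nat) (r : nat) : set (seq nat) :=
  [set s | [/\ partitions n s,
               forall x, x \in s -> ~~ odd x -> cong_to r L x
             & odd (num_even s)]].

Definition Q (m : nat) (L : set nat) (r : nat) : set (seq nat) :=
  [set s | [/\ partitions m s, uniq s
             & forall x, x \in s -> ~~ odd x -> ~ cong_to r L x]].

(* [a * b <= n] is explicit because [n - a * b] truncates at 0. *)
Definition Q_rect_pairs (n : nat) (L : set nat) (r : nat) :
    set (seq nat * seq nat) :=
  [set p | exists a b : nat,
      [/\ 0 < a, 0 < b & p.2 = nseq b a] /\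
      [/\ ~~ odd a, a * b <= n & Q (n - a * b) L r p.1]].

(* [\sum_(x \in A) _] and [fset_set A] take default values when [A] is
   infinite; the following facts show that this never happens here. *)
Lemma sumn_ge_mem (s : seq nat) x : x \in s -> x <= sumn s.
Proof.
elim: s => //= y s IH; rewrite inE => /orP[/eqP->|/IH xs].
  exact: leq_addr.
exact: leq_trans xs (leq_addl _ _).
Qed.

Lemma size_le_sumn (s : seq nat) : all (fun x => 0 < x) s -> size s <= sumn s.
Proof. by elim: s => //= y s IH /andP[y0 /IH h]; rewrite -add1n leq_add. Qed.

Lemma finite_partitions n : finite_set (partitions n).
Proof.
pose f (t : n.-bseq 'I_n.+1) : seq nat := map val t.
apply: (@sub_finite_set _ _ (f @` setT)); last exact/finite_image/finite_finset.
move=> s [/andP[_ s0] sn].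
have szs : size (map (@inord n) s) <= n by rewrite size_map -sn size_le_sumn.
exists (Bseq szs) => //; rewrite /f /= -map_comp map_id_in // => x xs /=.
by rewrite inordK // ltnS -sn sumn_ge_mem.
Qed.

Lemma finite_P_e n L r : finite_set (P_e n L r).
Proof. by apply: sub_finite_set (finite_partitions n) => s []. Qed.

Lemma finite_P_o n L r : finite_set (P_o n L r).
Proof. by apply: sub_finite_set (finite_partitions n) => s []. Qed.

Lemma finite_Q n L r : finite_set (Q n L r).
Proof. by apply: sub_finite_set (finite_partitions n) => s []. Qed.

Lemma finite_Q_rect_pairs n L r : finite_set (Q_rect_pairs n L r).
Proof.
pose U := \bigcup_(k in `I_n.+1) partitions k.
have fU : finite_set U.
  by apply: bigcup_finite => // k _; exact: finite_partitions.
apply: sub_finite_set (finite_setX fU fU) => -[l m] /=.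
move=> [a [b [[a0 b0 /= ->] [_ abn [Ql _ _]]]]]; split => /=.
  by exists (n - a * b) => //=; rewrite ltnS leq_subr.
exists (a * b) => //=; split; last by rewrite sumn_nseq mulnC.
rewrite /is_partition all_nseq a0 orbT andbT.
by elim: b {b0 abn Ql} => //= -[//|b] /= ->; rewrite /geq /= leqnn.
Qed.

(* Main.v *)
Require Import Defs.
From mathcomp Require Import all_boot all_order all_algebra finmap.
From mathcomp Require Import all_classical.
From mathcomp Require Import qpoly ring.

Set Implicit Arguments.
Unset Strict Implicit.
Unset Printing Implicit Defensive.

Import Order.TTheory GRing.Theory Num.Theory.
Local Open Scope classical_set_scope.
Local Open Scope ring_scope.

(* Let E be the set of admissible even parts. With z marking the length, the
   signed partitions have generating function
     F(z) = \prod_(a odd) 1/(1 - z q^a) * \prod_(a in E) 1/(1 + z q^a)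
   and the distinct ones
     G(z) = \prod_(a odd) (1 + z q^a) * \prod_(a even, not in E) (1 + z q^a).
   Euler's identity gives F(1) = G(1), so F'(1) - G'(1) is G(1) times the
   difference of the logarithmic derivatives, namely
     \sum_(a odd, j) (1 + (-1)^j) q^(aj) + \sum_(a even, j) (-1)^j q^(aj),
   in which E no longer occurs. The terms with a odd, j even and those with
   a even, j odd are exchanged by swapping a and j, so this sum equals
   \sum_(a even, j) q^(aj), and its product with G(1) counts the pairs.

   Power series are truncated: everything takes place in Z[q]/(q^(n+1)), where
   1 - c q^a is invertible by a finite geometric sum. The derivative at z = 1
   is taken by weighting, in turn, each part b by its multiplicity. *)

(** * Partitions as multiplicity functions *)

Lemma prod_count_mem (R : comNzRingType) n (g : nat -> R) (s : seq nat) :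
  all (fun a => 0 < a <= n)%N s ->
  \prod_(i < n) g i.+1 ^+ count_mem i.+1 s = \prod_(a <- s) g a.
Proof.
elim: s => [_|a s IH /= /andP[/andP[a0 an] /IH {}IH]].
  by rewrite big_nil big1 // => i _; rewrite expr0.
rewrite big_cons -IH; have an' : (a.-1 < n)%N by rewrite prednK.
rewrite (bigD1 (Ordinal an')) //= [in RHS](bigD1 (Ordinal an')) //=.
rewrite prednK // eqxx add1n exprS -mulrA; congr (_ * (_ * _)).
apply: eq_bigr => i neq_i; case: eqP => [ai|_]; last by rewrite add0n.
by move: neq_i; rewrite -val_eqE /= ai eqxx.
Qed.

Lemma sum_count_mem n (s : seq nat) :
  all (fun a => 0 < a <= n)%N s -> (\sum_(i < n) count_mem i.+1 s)%N = size s.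
Proof.
elim: s => [_|a s IH /= /andP[/andP[a0 an] /IH <-]]; first by rewrite big1.
have an' : (a.-1 < n)%N by rewrite prednK.
rewrite big_split /= (bigD1 (Ordinal an')) //= prednK // eqxx big1 ?addn0//.
move=> i neq_i; case: eqP => // ai.
by move: neq_i; rewrite -val_eqE /= ai eqxx.
Qed.

Lemma partitions_bounded n m s : (m <= n)%N -> partitions m s ->
  all (fun a => 0 < a <= n)%N s.
Proof.
move=> mn [/andP[_ /allP s0] sm]; apply/allP => a sa; rewrite s0 //=.
by apply: leq_trans (sumn_ge_mem sa) _; rewrite sm.
Qed.

(** Bounding parts and multiplicities by [n] loses no partition of any [m <= n] and makes the
    multiplicity functions a finite type. *)
Definition partition_of_mult n (phi : {ffun 'I_n -> 'I_n.+1}) : seq nat :=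
  sort geq (flatten [seq nseq (phi i) i.+1 | i : 'I_n]).

Lemma count_partition_of_mult n (phi : {ffun 'I_n -> 'I_n.+1}) (k : 'I_n) :
  count_mem k.+1 (partition_of_mult phi) = phi k.
Proof.
rewrite /partition_of_mult count_sort count_flatten -map_comp sumnE big_map.
rewrite big_enum /= (bigD1 k) //= count_nseq /= eqxx mul1n big1 ?addn0// => i.
by rewrite -val_eqE /= count_nseq /= eqSS => /negPf->.
Qed.

Lemma sumn_partition_of_mult n (phi : {ffun 'I_n -> 'I_n.+1}) :
  sumn (partition_of_mult phi) = (\sum_(i < n) i.+1 * phi i)%N.
Proof.
rewrite /partition_of_mult (perm_sumn (permEl (perm_sort _ _))).
rewrite sumn_flatten -map_comp sumnE big_map big_enum /=.
by apply: eq_bigr => i _; rewrite sumn_nseq.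
Qed.

Lemma mem_partition_of_mult n (phi : {ffun 'I_n -> 'I_n.+1}) a :
  a \in partition_of_mult phi -> exists i : 'I_n, a = i.+1.
Proof.
rewrite mem_sort => /flatten_mapP[i _]; rewrite mem_nseq => /andP[_ /eqP->].
by exists i.
Qed.

Lemma is_partition_of_mult n (phi : {ffun 'I_n -> 'I_n.+1}) :
  is_partition (partition_of_mult phi).
Proof.
apply/andP; split; first by apply: sort_sorted => a b; exact: leq_total.
by apply/allP => a /mem_partition_of_mult[i ->].
Qed.

Lemma partition_of_mult_inj n : injective (@partition_of_mult n).
Proof.
move=> phi psi eq_part; apply/ffunP => k; apply: val_inj => /=.
by rewrite -!count_partition_of_mult eq_part.
Qed.

Lemma partition_of_mult_count n m s : (m <= n)%N -> partitions m s ->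
  partition_of_mult [ffun i : 'I_n => inord (count_mem i.+1 s)] = s.
Proof.
move=> mn sP; have /allP bs := partitions_bounded mn sP.
case: sP => /andP[ss s0] sm.
apply: (@sorted_eq _ geq).
- by move=> a b c /= ab bc; apply: leq_trans bc ab.
- by move=> a b /= /andP[ab ba]; apply/eqP; rewrite eqn_leq ab ba.
- by apply: sort_sorted => a b; exact: leq_total.
- exact: ss.
(* Permutation equality means equal multiplicities on the entries of both lists. *)
apply/allP => a; rewrite mem_cat => a_in.
have [k ->] : exists k : 'I_n, a = k.+1.
  case/orP: a_in => [/mem_partition_of_mult//|/bs /andP[a0 an]].
  have an' : (a.-1 < n)%N by rewrite prednK.
  by exists (Ordinal an'); rewrite /= prednK.
(* [inord] is faithful here: a multiplicity is at most the size, hence at most [m]. *)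
rewrite /= count_partition_of_mult ffunE inordK // ltnS.
by apply: leq_trans (count_size _ _) _; rewrite (leq_trans (size_le_sumn s0)) ?sm.
Qed.

Definition partition_seq n m : seq (seq nat) :=
  [seq partition_of_mult phi |
    phi in [pred phi : {ffun 'I_n -> 'I_n.+1} |
             (\sum_(i < n) i.+1 * phi i)%N == m]].

Lemma partition_seq_uniq n m : uniq (partition_seq n m).
Proof. by rewrite map_inj_uniq ?enum_uniq //; exact: partition_of_mult_inj. Qed.

Lemma mem_partition_seq n m s : (m <= n)%N ->
  s \in partition_seq n m <-> partitions m s.
Proof.
move=> mn; split=> [/mapP[phi]|sP].
  rewrite mem_enum inE => /eqP phim ->.
  by split; [exact: is_partition_of_mult | rewrite sumn_partition_of_mult].
rewrite -(partition_of_mult_count mn sP); apply: map_f; rewrite mem_enum inE.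
by rewrite -sumn_partition_of_mult (partition_of_mult_count mn sP) sP.2.
Qed.

(** A common index list lets sums over different sets be combined term by term through
    indicators. *)
Lemma fsbig_partition_seq n m (P : set (seq nat)) (F : seq nat -> int) :
  (m <= n)%N -> P `<=` partitions m ->
  \sum_(s \in P) F s = \sum_(s <- partition_seq n m) (s \in P)%:R * F s.
Proof.
move=> mn sub; rewrite [RHS]fsbig_seq ?partition_seq_uniq //.
have -> : [set` partition_seq n m] = partitions m.
  by apply/seteqP; split=> s /=; rewrite mem_partition_seq.
rewrite -[in LHS](setIidr sub) fsbig_mkcondr; apply: eq_fsbigr => s _.
by case: ifP; rewrite ?mul1r ?mul0r.
Qed.

(* The factor of the generating function contributed by the part [a], when a
   partition with multiplicities [m_a] has weight [\prod_a f a m_a]. *)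
Definition part_factor (A : comNzRingType) (x : A) n (f : nat -> nat -> int) a :=
  \sum_(j < n.+1) (f a j)%:~R * x ^+ (a * j).

Lemma rmorph_part_factor (A B : comNzRingType) (h : {rmorphism A -> B}) x n f a :
  h (part_factor x n f a) = part_factor (h x) n f a.
Proof.
rewrite rmorph_sum; apply: eq_bigr => j _.
by rewrite rmorphM rmorph_int rmorphXn.
Qed.

(** Expanding the product chooses one [j] per part, that is, a multiplicity function; the
    coefficient keeps those of total [m]. *)
Lemma coef_prod_part_factor n m f :
  (\prod_(i < n) part_factor ('X : {poly int}) n f i.+1)`_m =
  \sum_(s <- partition_seq n m) \prod_(i < n) f i.+1 (count_mem i.+1 s).
Proof.
rewrite bigA_distr_bigA coef_sum big_image /= [RHS]big_mkcond /=.
apply: eq_bigr => phi _.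
rewrite big_split /= -expr_sum -(rmorph_prod intr) /=.
rewrite -(rmorph_int polyC) coefCM coefXn intz eq_sym inE.
case: ifP => _; rewrite ?mulr0 // mulr1.
by apply: eq_bigr => i _; rewrite count_partition_of_mult.
Qed.

(** * Identities in a ring with a nilpotent element *)

(* [D] selects the admissible even parts; its values at odd parts are
   irrelevant. *)
Definition signed_weight (D : pred nat) a : int :=
  if odd a then 1 else - (D a)%:R.
Definition distinct_weight (D : pred nat) a : int := (odd a || ~~ D a)%:R.

Definition mult_signed (D : pred nat) a j : int := signed_weight D a ^+ j.
(** A forbidden part has weight 0, and [0 ^+ 0 = 1] lets it occur zero times only. *)
Definition mult_distinct (D : pred nat) a j : int :=
  if (j <= 1)%N then distinct_weight D a ^+ j else 0.

Definition marked (f : nat -> nat -> int) b a j : int :=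
  f a j * (if a == b then j%:R else 1).

Section NilpotentIdentities.
Variables (A : comNzRingType) (x : A) (n : nat).
Hypothesis x_nil : x ^+ n.+1 = 0.

Lemma expr_nilp k : (n < k)%N -> x ^+ k = 0.
Proof. by move=> nk; rewrite -(subnK nk) exprD x_nil mulr0. Qed.

(** * Truncated geometric series *)

Section Geometric.
Variables (c : A) (a : nat).
Hypothesis a_gt0 : (0 < a)%N.
Let y := c * x ^+ a.

Lemma monomial_nilp : y ^+ n.+1 = 0.
Proof.
by rewrite exprMn -exprM expr_nilp ?mulr0 // -{1}[n.+1]mul1n leq_mul2r a_gt0 orbT.
Qed.

Lemma geometric_sum : (1 - y) * \sum_(j < n.+1) y ^+ j = 1.
Proof. by rewrite -opprB mulNr -subrX1 monomial_nilp sub0r opprK. Qed.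

Lemma geometric_sum_tail :
  \sum_(j < n) y ^+ j.+1 = y * \sum_(j < n.+1) y ^+ j.
Proof.
rewrite big_ord_recr /= mulrDr -exprS monomial_nilp addr0 mulr_sumr.
by apply: eq_bigr => j _; rewrite exprS.
Qed.

(** Applying [y d/dy] to [1 / (1 - y)] multiplies it by [y / (1 - y)], which is the tail sum. *)
Lemma geometric_derivative :
  \sum_(j < n.+1) j%:R * y ^+ j =
  (\sum_(j < n) y ^+ j.+1) * \sum_(j < n.+1) y ^+ j.
Proof.
set u := \sum_(j < n.+1) y ^+ j; set d := \sum_(j < n.+1) _.
(* Multiplying by [1 - y] takes differences of consecutive coefficients [j], leaving 1 at every
   positive exponent. *)
have yd : (1 - y) * d = y * u.
  rewrite -geometric_sum_tail mulrBl mul1r {2}/d big_ord_recr /= mulrDr.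
  rewrite mulrCA -exprS monomial_nilp mulr0 addr0 /d big_ord_recl /= mul0r add0r.
  rewrite mulr_sumr -sumrB; apply: eq_bigr => j _.
  by rewrite /bump /= add1n mulrCA -exprS -mulrBl -natrB // subSnn mul1r.
rewrite geometric_sum_tail -/u.
have := geometric_sum; rewrite -/u => yu.
by rewrite -[LHS]mul1r -[X in X * d]yu mulrAC yd.
Qed.

End Geometric.

(** * Factors of single parts and their logarithmic derivatives *)

Variable D : pred nat.
Let s a : A := (signed_weight D a)%:~R.
Let t a : A := (distinct_weight D a)%:~R.

Let sE a : s a = if odd a then 1 else - (D a)%:R.
Proof.
by rewrite /s /signed_weight; case: ifP => _; rewrite ?rmorph1 // rmorphN rmorph_nat.
Qed.

Let tE a : t a = (odd a || ~~ D a)%:R.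
Proof. exact: rmorph_nat. Qed.

Lemma part_factor_signed a :
  part_factor x n (mult_signed D) a = \sum_(j < n.+1) (s a * x ^+ a) ^+ j.
Proof.
by apply: eq_bigr => j _; rewrite rmorphXn /= exprMn -exprM.
Qed.

Lemma part_factor_distinct a : (0 < n)%N ->
  part_factor x n (mult_distinct D) a = 1 + t a * x ^+ a.
Proof.
rewrite /part_factor /mult_distinct; case: n => // n' _.
rewrite !big_ord_recl /= big1 ?addr0 => [|j _]; last by rewrite /= mul0r.
by rewrite /bump /= muln0 muln1 mul1r expr1.
Qed.

Lemma part_factor_marked_eq f a :
  part_factor x n (marked f a) a =
  \sum_(j < n.+1) j%:R * ((f a j)%:~R * x ^+ (a * j)).
Proof.
apply: eq_bigr => j _; rewrite /marked eqxx rmorphM /= mulrA.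
by rewrite [_%:~R * _]mulrC rmorph_nat.
Qed.

Lemma part_factor_marked_neq f a b : a != b ->
  part_factor x n (marked f b) a = part_factor x n f a.
Proof.
by move=> /negPf ab; apply: eq_bigr => j _; rewrite /marked ab mulr1.
Qed.

(** Leibniz rule: marking one factor multiplies the product by its logarithmic derivative [T b]. *)
Lemma sum_marked_prod f (T : 'I_n -> A) :
  (forall i : 'I_n,
     part_factor x n (marked f i.+1) i.+1 = T i * part_factor x n f i.+1) ->
  \sum_(b < n) \prod_(i < n) part_factor x n (marked f b.+1) i.+1 =
  (\sum_(b < n) T b) * \prod_(i < n) part_factor x n f i.+1.
Proof.
move=> fT; rewrite mulr_suml; apply: eq_bigr => b _.
rewrite (bigD1 b) //= [in RHS](bigD1 b) //= mulrA fT; congr (_ * _).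
by apply: eq_bigr => i ib; rewrite part_factor_marked_neq // eqSS.
Qed.

Lemma marked_signed (i : 'I_n) :
  part_factor x n (marked (mult_signed D) i.+1) i.+1 =
  (\sum_(j < n) (s i.+1 * x ^+ i.+1) ^+ j.+1) *
  part_factor x n (mult_signed D) i.+1.
Proof.
rewrite part_factor_marked_eq part_factor_signed -geometric_derivative //.
by apply: eq_bigr => j _; rewrite rmorphXn /= exprMn -exprM.
Qed.

(** The logarithmic derivative [t x^a / (1 + t x^a)] is written as a geometric tail in [- t x^a] to
    match the signed side. *)
Lemma marked_distinct (i : 'I_n) :
  part_factor x n (marked (mult_distinct D) i.+1) i.+1 =
  (- \sum_(j < n) (- t i.+1 * x ^+ i.+1) ^+ j.+1) *
  part_factor x n (mult_distinct D) i.+1.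
Proof.
have n_gt0 : (0 < n)%N by case: n i => [[]|].
have -> : part_factor x n (marked (mult_distinct D) i.+1) i.+1 =
    t i.+1 * x ^+ i.+1.
  rewrite part_factor_marked_eq; move: (i : nat) => k; case: n n_gt0 => // n' _.
  rewrite !big_ord_recl /= big1 ?addr0 => [|j _].
    by rewrite mul0r add0r /mult_distinct /bump /= muln1 mul1r expr1.
  by rewrite /mult_distinct /= mul0r mulr0.
rewrite part_factor_distinct // geometric_sum_tail //.
have := @geometric_sum (- t i.+1) i.+1 isT.
set u := \sum_(j < n.+1) _ => yu.
rewrite mulNr opprK in yu.
by rewrite !mulNr opprK -mulrA [u * _]mulrC yu mulr1.
Qed.

(** * Euler's identity and the difference of logarithmic derivatives *)

(** The doubled exponents reach [2n], but those beyond [n] give factors 1 because the powers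
    vanish. *)
Lemma prod_even_factor :
  \prod_(i < n) (1 - x ^+ i.+1.*2) =
  \prod_(i < n | ~~ odd i.+1) (1 - x ^+ i.+1).
Proof.
rewrite -(big_mkord predT (fun i => 1 - x ^+ i.+1.*2)).
rewrite -(big_mkord (fun i => ~~ odd i.+1) (fun i => 1 - x ^+ i.+1)).
have -> : \prod_(0 <= i < n | ~~ odd i.+1) (1 - x ^+ i.+1) =
    \prod_(0 <= i < n.*2 | ~~ odd i.+1) (1 - x ^+ i.+1).
  rewrite [RHS](@big_cat_nat _ _ _ n) //=; last by rewrite -addnn leq_addr.
  rewrite [X in _ = _ * X]big_nat_cond [X in _ = _ * X]big1 ?mulr1 // => i.
  by move=> /andP[/andP[ni _] _]; rewrite expr_nilp ?subr0.
(* Each step adds one odd and one even exponent, and the odd one is filtered out. *)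
rewrite [RHS]big_mkcond; elim: (n) => [|k IH]; first by rewrite !big_geq.
by rewrite doubleS !big_nat_recr //= IH odd_double mulr1 -doubleS.
Qed.

(** Since [(1 + x^a) (1 - x^a) = 1 - x^(2a)], multiplying the left side by the even product [Ev]
    gives [Ev] back, and [Ev] is invertible. *)
Lemma euler_odd_distinct :
  \prod_(i < n) (1 + x ^+ i.+1) * \prod_(i < n | odd i.+1) (1 - x ^+ i.+1) = 1.
Proof.
pose v i := \sum_(j < n.+1) (x ^+ i.+1) ^+ j.
have vK i : (1 - x ^+ i.+1) * v i = 1.
  by have := @geometric_sum 1 i.+1 isT; rewrite mul1r.
set Ev := \prod_(i < n | ~~ odd i.+1) (1 - x ^+ i.+1).
have EvK : Ev * \prod_(i < n | ~~ odd i.+1) v i = 1.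
  by rewrite -big_split /= big1.
have EvE : Ev = \prod_(i < n) (1 + x ^+ i.+1) *
    \prod_(i < n | odd i.+1) (1 - x ^+ i.+1) * Ev.
  rewrite -mulrA -(bigID (fun i : 'I_n => odd i.+1) predT) -big_split /=.
  rewrite /Ev -prod_even_factor; apply: eq_bigr => i _.
  by rewrite -addnn exprD; ring.
by rewrite -[LHS]mulr1 -[X in _ * X = _]EvK mulrA -EvE EvK.
Qed.

(** After multiplication by Euler's identity the factors agree part by part: the series of an odd
    part cancels [1 - x^a], that of an admissible even part cancels [1 + x^a], and that of any other
    even part is 1. *)
Lemma prod_signed_distinct :
  \prod_(i < n) part_factor x n (mult_signed D) i.+1 =
  \prod_(i < n) part_factor x n (mult_distinct D) i.+1.
Proof.
have sK i : (1 - s i.+1 * x ^+ i.+1) * part_factor x n (mult_signed D) i.+1 = 1.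
  by rewrite part_factor_signed geometric_sum.
rewrite -[LHS]mul1r -[X in X * _ = _]euler_odd_distinct [X in _ * X * _]big_mkcond /=.
rewrite -!big_split /=; apply: eq_bigr => i _.
have n_gt0 : (0 < n)%N by case: n i => [[]|].
rewrite part_factor_distinct //; move: (sK i).
rewrite sE tE /=.
case: (odd i) => /=; last by rewrite mul1r -mulrA => ->; rewrite mulr1.
case: (D i.+1) => /=; rewrite ?mulr1.
  by rewrite mulN1r opprK mul0r addr0.
by rewrite oppr0 mul0r subr0 !mul1r => ->; rewrite mulr1.
Qed.

Lemma log_derivative_difference :
  \sum_(i < n) \sum_(j < n) (s i.+1 * x ^+ i.+1) ^+ j.+1 -
  \sum_(i < n) - \sum_(j < n) (- t i.+1 * x ^+ i.+1) ^+ j.+1 =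
  \sum_(i < n | ~~ odd i.+1) \sum_(j < n) x ^+ (i.+1 * j.+1).
Proof.
(* The two sides will differ termwise by [g i j - g j i], which sums to 0 by exchanging the
   indices. *)
pose g (i j : 'I_n) : A := (odd i.+1 && ~~ odd j.+1)%:R * (2 * x ^+ (i.+1 * j.+1)).
have swap : \sum_(i < n) \sum_(j < n) g i j = \sum_(i < n) \sum_(j < n) g j i.
  by rewrite exchange_big.
rewrite [RHS]big_mkcond -sumrB.
apply/eqP; rewrite -subr_eq0 -sumrB.
apply/eqP; transitivity (\sum_(i < n) (\sum_(j < n) g i j - \sum_(j < n) g j i));
  last by rewrite sumrB swap subrr.
apply: eq_bigr => i _; rewrite opprK -big_split -sumrB.
have -> : (if ~~ odd i.+1 then \sum_(j < n) x ^+ (i.+1 * j.+1) else 0) =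
    \sum_(j < n) (~~ odd i.+1)%:R * x ^+ (i.+1 * j.+1).
  by rewrite -mulr_sumr; case: ifP; rewrite ?mul1r ?mul0r.
rewrite -sumrB; apply: eq_bigr => j _.
rewrite /g [(j.+1 * i.+1)%N]mulnC !exprMn -!exprM sE tE /=.
have sgn : (-1) ^+ j.+1 = (if odd j.+1 then -1 else 1) :> A.
  by rewrite -signr_odd; case: (odd _).
case oi: (odd i); rewrite /=; last first.
  by rewrite expr1n sgn /=; case: (odd j) => /=; ring.
(* For an even part one of the bases [s], [- t] is [-1] and the other 0, whose positive powers
   vanish. *)
case: (D i.+1); rewrite /= ?oppr0 ?sgn ?expr0n /=.
  by case: (odd j) => /=; ring.
by case: (odd j) => /=; ring.
Qed.

Lemma marked_difference :
  \sum_(b < n) \prod_(i < n) part_factor x n (marked (mult_signed D) b.+1) i.+1 -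
  \sum_(b < n) \prod_(i < n) part_factor x n (marked (mult_distinct D) b.+1) i.+1 =
  \sum_(i < n | ~~ odd i.+1) \sum_(j < n)
    x ^+ (i.+1 * j.+1) * \prod_(i < n) part_factor x n (mult_distinct D) i.+1.
Proof.
rewrite (sum_marked_prod marked_signed) (sum_marked_prod marked_distinct).
rewrite prod_signed_distinct -mulrBl log_derivative_difference mulr_suml.
by apply: eq_bigr => i _; rewrite mulr_suml.
Qed.

End NilpotentIdentities.

(** * Coefficients and cardinalities *)

(** Each [b] weights a partition by the multiplicity of [b.+1]; over all [b] these add up to its
    length. *)
Lemma coef_sum_marked n m f : (m <= n)%N ->
  (\sum_(b < n) \prod_(i < n)
      part_factor ('X : {poly int}) n (marked f b.+1) i.+1)`_m =
  \sum_(s <- partition_seq n m)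
    (\prod_(i < n) f i.+1 (count_mem i.+1 s)) * (size s)%:R.
Proof.
move=> mn; rewrite coef_sum.
under eq_bigr do rewrite coef_prod_part_factor.
rewrite exchange_big /= big_seq [RHS]big_seq; apply: eq_bigr => s.
rewrite mem_partition_seq // => /(partitions_bounded mn) bs.
rewrite -(sum_count_mem bs) natr_sum mulr_sumr; apply: eq_bigr => b _.
rewrite big_split /=; congr (_ * _).
by rewrite (bigD1 b) //= eqxx big1 ?mulr1 // => i ib; rewrite eqSS ifN.
Qed.

(** Reduction modulo [X^(n+1)] keeps the coefficients of degree at most [n]. *)
Lemma eq_coef_in_qpoly (R : comNzRingType) n (p q : {poly R}) k : (k <= n)%N ->
  in_qpoly 'X^(n.+1) p = in_qpoly 'X^(n.+1) q -> p`_k = q`_k.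
Proof.
move=> kn /(congr1 val) /=; rewrite mk_monic_Xn => pq.
have coef_mod (u : {poly R}) : u`_k = (Pdiv.Ring.rmodp u 'X^(n.+1))`_k.
  rewrite [in LHS](Pdiv.RingMonic.rdivp_eq (monicXn R n.+1) u).
  by rewrite coefD coefMXn ltnS kn add0r.
by rewrite coef_mod pq -coef_mod.
Qed.

Lemma coef_marked_difference n D :
  (\sum_(b < n) \prod_(i < n)
     part_factor ('X : {poly int}) n (marked (mult_signed D) b.+1) i.+1)`_n -
  (\sum_(b < n) \prod_(i < n)
     part_factor ('X : {poly int}) n (marked (mult_distinct D) b.+1) i.+1)`_n =
  \sum_(i < n | ~~ odd i.+1) \sum_(j < n | (i.+1 * j.+1 <= n)%N)
    (\prod_(k < n) part_factor ('X : {poly int}) n (mult_distinct D) k.+1)`_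
      (n - i.+1 * j.+1).
Proof.
set H := \prod_(k < n) _; rewrite -coefB.
transitivity (\sum_(i < n | ~~ odd i.+1) \sum_(j < n) ('X^(i.+1 * j.+1) * H))`_n.
  pose x := in_qpoly ('X^(n.+1) : {poly int}) 'X.
  have x_nil : x ^+ n.+1 = 0.
    rewrite -rmorphXn; apply: val_inj => /=.
    by rewrite mk_monic_Xn Pdiv.RingMonic.rmodpp // monicXn.
  have prodE f : in_qpoly 'X^(n.+1) (\prod_(i < n) part_factor 'X n f i.+1) =
      \prod_(i < n) part_factor x n f i.+1.
    by rewrite rmorph_prod; apply: eq_bigr => i _; rewrite rmorph_part_factor.
  apply: (@eq_coef_in_qpoly _ n) => //; rewrite rmorphB !rmorph_sum /=.
  under eq_bigr do rewrite prodE.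
  under [X in _ - X]eq_bigr do rewrite prodE.
  rewrite (marked_difference x_nil D); apply: eq_bigr => i _.
  rewrite rmorph_sum; apply: eq_bigr => j _.
  by rewrite rmorphM rmorphXn /= /H prodE.
(* Multiples of a monomial of degree above [n] have no coefficient at [n]; hence the condition on
   [i.+1 * j.+1]. *)
rewrite coef_sum; apply: eq_bigr => i _; rewrite coef_sum [RHS]big_mkcond /=.
by apply: eq_bigr => j _; rewrite coefXnM ltnNge; case: leqP.
Qed.

(** * Weights of partitions as indicators *)

Lemma prod_signed_weight D s :
  \prod_(a <- s) signed_weight D a =
  if all (fun a => odd a || D a) s then (-1) ^+ num_even s else 0.
Proof.
elim: s => [|a s IH]; first by rewrite big_nil.
rewrite big_cons IH /signed_weight /num_even /=.
case: (odd a) => /=; first by rewrite mul1r.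
by case: (D a) => /=; rewrite ?oppr0 ?mul0r // add1n exprS; case: ifP; rewrite ?mulr0.
Qed.

Lemma prod_distinct_weight D s :
  \prod_(a <- s) distinct_weight D a = (all (fun a => odd a || ~~ D a) s)%:R.
Proof.
elim: s => [|a s IH]; first by rewrite big_nil.
by rewrite big_cons IH /distinct_weight /= -natrM mulnb.
Qed.

Lemma uniq_count_le1 (T : eqType) (s : seq T) :
  (forall a, a \in s -> count_mem a s <= 1)%N -> uniq s.
Proof.
move=> cs; apply: count_mem_uniq => a; case: (boolP (a \in s)) => [sa|/count_memPn//].
by apply/eqP; rewrite eqn_leq cs //= -has_count has_pred1.
Qed.

Lemma prod_mult_distinct_uniq n D s : all (fun a => 0 < a <= n)%N s ->
  \prod_(i < n) mult_distinct D i.+1 (count_mem i.+1 s) =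
  (uniq s && all (fun a => odd a || ~~ D a) s)%:R.
Proof.
move=> bs; case: (boolP (uniq s)) => us /=.
  rewrite -prod_distinct_weight -(prod_count_mem _ bs).
  by apply: eq_bigr => i _; rewrite /mult_distinct count_uniq_mem // leq_b1.
(* Some part is repeated, and its weight 0 kills the product. *)
have : ~~ [forall i : 'I_n, (count_mem i.+1 s <= 1)%N].
  apply: contra us => /forallP cs; apply: uniq_count_le1 => a sa.
  have /andP[a0 an] := allP bs _ sa.
  have an' : (a.-1 < n)%N by rewrite prednK.
  by have := cs (Ordinal an'); rewrite /= prednK.
rewrite negb_forall => /existsP[i /negPf ci].
by rewrite (bigD1 i) //= /mult_distinct ci mul0r.
Qed.

(** The sign [(-1) ^+ num_even s] separates [P_e] from [P_o]; a forbidden even part makes the weight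
    0. *)
Lemma prod_mult_signed_mem n L r s : partitions n s ->
  \prod_(i < n) mult_signed (fun a => `[< cong_to r L a >]) i.+1 (count_mem i.+1 s)
  = (s \in P_e n L r)%:R - (s \in P_o n L r)%:R.
Proof.
move=> sP; rewrite prod_count_mem ?(partitions_bounded (leqnn n) sP) //.
rewrite prod_signed_weight.
have allE : (forall x, x \in s -> ~~ odd x -> cong_to r L x) <->
    all (fun a => odd a || `[< cong_to r L a >]) s.
  split=> [h|/allP h a /h /orP[->//|/asboolP //]].
  apply/allP => a sa; case: (boolP (odd a)) => //= oa; apply/asboolP; exact: h.
have -> : (s \in P_e n L r) =
    all (fun a => odd a || `[< cong_to r L a >]) s && ~~ odd (num_even s).
  by apply/idP/andP; rewrite inE => -[]; rewrite -allE.
have -> : (s \in P_o n L r) =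
    all (fun a => odd a || `[< cong_to r L a >]) s && odd (num_even s).
  by apply/idP/andP; rewrite inE => -[]; rewrite -allE.
case: (all _ _) => /=; last by rewrite subrr.
by rewrite -signr_odd; case: (odd _).
Qed.

Lemma prod_mult_distinct_mem n m L r s : (m <= n)%N -> partitions m s ->
  \prod_(i < n) mult_distinct (fun a => `[< cong_to r L a >]) i.+1 (count_mem i.+1 s)
  = (s \in Q m L r)%:R.
Proof.
move=> mn sP; rewrite prod_mult_distinct_uniq ?(partitions_bounded mn sP) //.
congr (nat_of_bool _)%:R; apply/andP/idP; rewrite inE.
  move=> [us /allP h]; split=> // a /h /orP[->//|/asboolPn //].
move=> [_ us h]; split=> //; apply/allP => a /h.
by case: (odd a) => //= /(_ isT)/asboolPn.
Qed.

Lemma card_Q_rect_pairs n L r :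
  #|` fset_set (Q_rect_pairs n L r)| =
  (\sum_(i < n | ~~ odd i.+1) \sum_(j < n | i.+1 * j.+1 <= n)
    count (fun s => s \in Q (n - i.+1 * j.+1) L r)
      (partition_seq n (n - i.+1 * j.+1)))%N.
Proof.
pose rect := [pred p : 'I_n * 'I_n | ~~ odd p.1.+1 & p.1.+1 * p.2.+1 <= n]%N.
pose w (p : 'I_n * 'I_n) := (n - p.1.+1 * p.2.+1)%N.
pose Qs p := [seq s <- partition_seq n (w p) | s \in Q (w p) L r].
pose rect_pair (p : 'I_n * 'I_n) (s : seq nat) := (s, nseq p.2.+1 (p.1.+1 : nat)).
pose pairs := [seq rect_pair p s | p <- enum rect, s <- Qs p].
have pairs_uniq : uniq pairs.
  apply: allpairs_uniq_dep; first exact: enum_uniq.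
    by move=> p _; rewrite filter_uniq ?partition_seq_uniq.
  (* The rectangles are nonempty, so first entry and size recover [a] and [b]. *)
  move=> [[i j] s] [[i' j'] s'] _ _ /= [-> eqi eqn].
  have eqj : j = j'.
    apply: val_inj; have := congr1 size eqn; rewrite !size_nseq; exact.
  by rewrite eqj (val_inj eqi : i = i').
have pairsE : fset_set (Q_rect_pairs n L r) =i pairs.
  move=> [s b]; rewrite in_fset_set; last exact: finite_Q_rect_pairs.
  apply/idP/idP.
    rewrite inE => -[a [k [[a0 k0 /= ->] [a_even akn sQ]]]].
    case: a a0 a_even akn sQ => // a _ a_even akn sQ.
    case: k k0 akn sQ => // k _ akn sQ.
    (* Each side of the rectangle is at most its area, hence at most [n], so its predecessor lies in
       ['I_n]. *)
    have an : (a < n)%N by rewrite (leq_trans _ akn) // leq_pmulr.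
    have kn : (k < n)%N by rewrite (leq_trans _ akn) // leq_pmull.
    apply/allpairsPdep; exists (Ordinal an, Ordinal kn), s.
    rewrite mem_enum mem_filter; split=> //; first exact/andP.
    apply/andP; split; first exact/mem_set.
    by case: sQ => sP _ _; apply/(mem_partition_seq _ (leq_subr _ _)).
  move=> /allpairsPdep[[i j] [s' []]]; rewrite mem_enum mem_filter !inE /=.
  move=> /andP[i_even ijn] /andP[/set_mem sQ _] [-> ->].
  by exists i.+1, j.+1.
have -> : #|` fset_set (Q_rect_pairs n L r)| = size pairs.
  by apply/perm_size/uniq_perm => //; exact: fset_uniq.
rewrite size_allpairs_dep sumnE big_map big_enum /= pair_big_dep /=.
by apply: eq_bigr => p _; rewrite size_filter.
Qed.

Theorem theorem1p8 (r : nat) (L : set nat) (n : nat)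
    (r_gt0 : (0 < r)%N)
    (L_neq0 : L !=set0)
    (L_sub : L `<=` [set (2 * i)%N | i in [set i | (1 <= i <= r)%N]]) :
  (\sum_(la \in P_e n L r) (ell la)%:Z)
  - (\sum_(la \in P_o n L r) (ell la)%:Z)
  - (\sum_(la \in Q n L r) (ell la)%:Z)
  = (#|` fset_set (Q_rect_pairs n L r) |)%:Z.
Proof.
rewrite !(@fsbig_partition_seq n n) //; try by move=> s [].
pose D a := `[< cong_to r L a >].
have -> : \sum_(s <- partition_seq n n) (s \in P_e n L r)%:R * (ell s)%:Z -
          \sum_(s <- partition_seq n n) (s \in P_o n L r)%:R * (ell s)%:Z =
    (\sum_(b < n) \prod_(i < n)
       part_factor ('X : {poly int}) n (marked (mult_signed D) b.+1) i.+1)`_n.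
  rewrite coef_sum_marked // -sumrB big_seq [RHS]big_seq; apply: eq_bigr => s.
  rewrite mem_partition_seq // => sP.
  by rewrite prod_mult_signed_mem // mulrBl !natz.
have -> : \sum_(s <- partition_seq n n) (s \in Q n L r)%:R * (ell s)%:Z =
    (\sum_(b < n) \prod_(i < n)
       part_factor ('X : {poly int}) n (marked (mult_distinct D) b.+1) i.+1)`_n.
  rewrite coef_sum_marked // big_seq [RHS]big_seq; apply: eq_bigr => s.
  rewrite mem_partition_seq // => sP.
  by rewrite (prod_mult_distinct_mem _ _ _ sP) // !natz.
rewrite coef_marked_difference card_Q_rect_pairs -natz natr_sum.
apply: eq_bigr => i _; rewrite natr_sum; apply: eq_bigr => j _.
rewrite coef_prod_part_factor -sum1_count natr_sum [RHS]big_mkcond /=.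
rewrite big_seq [RHS]big_seq; apply: eq_bigr => s.
rewrite mem_partition_seq ?leq_subr // => sP.
by rewrite (prod_mult_distinct_mem _ _ _ sP) ?leq_subr //; case: (_ \in _).
Qed.
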